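(* Let $m\in\omega$ and let $(X_n)_{n\in\omega}$ be scattered spaces, each of scattered height at most $m$. Then the box product $\square_n X_n$ and the nabla product $\nabla_n X_n$ are both hereditarily $D$.
   Context: For a space $X$ let $\mathrm{I}(X)$ be its set of isolated points. Put $X^{(0)}=X$, $X^{(\alpha+1)}=X^{(\alpha)}\setminus \mathrm{I}(X^{(\alpha)})$, and $X^{(\lambda)}=\bigcap_{\alpha<\lambda}X^{(\alpha)}$ for limit $\lambda$. $X$ is scattered if every nonempty subspace has an isolated point (equivalently, some $X^{(\alpha)}=\emptyset$), and then its scattered height is $\mathrm{ht}(X)=\sup\{\alpha: X^{(\alpha)}\neq\emptyset\}$. A neighbornet on a space $(X,\tau)$ is a map $U:X\to\tau$ with $x\in U(x)$ for all $x\in X$. $X$ is a $D$-space if for every neighbornet $U$ on $X$ there is a closed discrete $D\subseteq X$ with $\bigcup_{x\in D}U(x)=X$. A space is hereditarily $D$ if each of its subspaces is a $D$-space. $\square_n X_n$ is the set $\prod_n X_n$ with the topology generated by all sets $\prod_n U_n$ with every $U_n$ open in $X_n$. $\nabla_n X_n$ is the quotient space $(\square_n X_n)/{=^*}$, where $x=^*y$ iff $x(n)=y(n)$ for all but finitely many $n$.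
   Formalization: Each space X_n is additionally assumed to be T1; without a separation axiom the claim fails, e.g. when every X_n is the Sierpinski space, whose box product has the non-D subspace of final segments of ω. *)

(* Defs.v *)
From HB Require Import structures.
From mathcomp Require Import all_boot all_classical.
From mathcomp Require Import topology.

Set Implicit Arguments.
Unset Strict Implicit.
Unset Printing Implicit Defensive.

Local Open Scope classical_set_scope.
Local Open Scope quotient_scope.

(* Terms denoting ordinals: [OLim f] is the supremum of the ordinals [f j], so
   every limit ordinal is of this form.  An ordinal has several such terms,
   but [ord_le_nat] and [cb_derivative] depend only on the ordinal denoted. *)
Inductive Ord : Type :=
  | OZero : Ord
  | OSucc : Ord -> Ord
  | OLim : forall J : Type, (J -> Ord) -> Ord.

(* [ord_le_nat a m] means a <= m, for a finite ordinal m. *)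
Fixpoint ord_le_nat (a : Ord) (m : nat) : Prop :=
  match a with
  | OZero => True
  | OSucc b => if m is k.+1 then ord_le_nat b k else False
  | OLim J f => forall j : J, ord_le_nat (f j) m
  end.

(* [isolated A] is the set of isolated points of the subspace A. *)
Fixpoint cb_derivative (X : topologicalType) (a : Ord) : set X :=
  match a with
  | OZero => setT
  | OSucc b => @cb_derivative X b `\` isolated (@cb_derivative X b)
  | OLim J f => \bigcap_(j in [set: J]) @cb_derivative X (f j)
  end.
Arguments cb_derivative : clear implicits.

Definition scattered (X : topologicalType) : Prop :=
  forall A : set X, A !=set0 -> isolated A !=set0.

(* sup {a : X^(a) is nonempty} <= m *)
Definition scattered_height_le (X : topologicalType) (m : nat) : Prop :=
  forall a : Ord, cb_derivative X a !=set0 -> ord_le_nat a m.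

Definition neighbornet (X : topologicalType) (U : X -> set X) : Prop :=
  forall x, open (U x) /\ U x x.

(* Every point of D is isolated in the subspace D. *)
Definition discrete_subset (X : topologicalType) (D : set X) : Prop :=
  isolated D = D.

Definition D_space (X : topologicalType) : Prop :=
  forall U : X -> set X, neighbornet U ->
  exists D : set X,
    [/\ closed D, discrete_subset D & \bigcup_(x in D) U x = setT].

(* The coercion of A to the type [set_type A] carries the subspace topology. *)
Definition hereditarily_D (X : topologicalType) : Prop :=
  forall A : set X, D_space A.

(* An alias, because the library puts the Tychonoff topology on products. *)
Definition box_product (X : nat -> topologicalType) : Type := forall n, X n.

Definition box (X : nat -> topologicalType) (U : forall n, set (X n)) :
    set (box_product X) :=
  [set x | forall n, U n (x n)].

Section box_topology.
Variable X : nat -> topologicalType.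

HB.instance Definition _ := Choice.copy (box_product X) (forall n, X n).

Let open_family : set (forall n, set (X n)) := [set U | forall n, open (U n)].

Let box_cover : \bigcup_(U in open_family) box U = setT.
Proof.
apply/seteqP; split=> // x _; exists (fun n => setT) => // n.
exact: openT.
Qed.

Let box_join (U V : forall n, set (X n)) (x : box_product X) :
    open_family U -> open_family V -> box U x -> box V x ->
  exists W, [/\ open_family W, box W x & box W `<=` box U `&` box V].
Proof.
move=> oU oV Ux Vx; exists (fun n => U n `&` V n); split.
- by move=> n; exact: openI.
- by move=> n; split.
- by move=> y Wy; split=> n; case: (Wy n).
Qed.

HB.instance Definition _ :=
  isBaseTopological.Build (box_product X) box_cover box_join.

End box_topology.

Section nabla.
Variable X : nat -> topologicalType.

Definition almost_eq (x y : box_product X) : bool :=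
  `[< finite_set [set n | x n <> y n] >].

Lemma almost_eq_refl : reflexive almost_eq.
Proof.
move=> x; apply/asboolP; rewrite (_ : [set _ | _] = set0)//.
by apply/seteqP; split.
Qed.

Lemma almost_eq_sym : symmetric almost_eq.
Proof.
move=> x y; apply/asboolP/asboolP; apply: sub_finite_set => n /= + e;
  by apply; rewrite e.
Qed.

Lemma almost_eq_trans : transitive almost_eq.
Proof.
move=> y x z /asboolP fxy /asboolP fyz; apply/asboolP.
apply: (@sub_finite_set _ _ ([set n | x n <> y n] `|` [set n | y n <> z n])).
  move=> n /= xz; have [xy|] := pselect (x n = y n); last by left.
  by right; rewrite -xy.
by rewrite finite_setU; split.
Qed.

Canonical almost_eq_equiv :=
  EquivRel almost_eq almost_eq_refl almost_eq_sym almost_eq_trans.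

Definition nabla_product : topologicalType :=
  quotient_topology {eq_quot almost_eq_equiv}.

End nabla.

(* Main.v *)
Require Import Defs.
From mathcomp Require Import all_boot all_classical.
From mathcomp Require Import topology.

(** In a factor X_n of height at most m, every point x has a Cantor-Bendixson
    rank r x <= m, and the points of smaller rank together with x itself form an
    open set ([scattered_height_rank]).  Write x <= y if x = y or r x < r y; this
    is a partial order.  Both products are handled at once, as products modulo a
    filter F on the indices: all indices for the box product, the cofinite
    filter for the nabla product.  Let N z be the set of the t with t n <= z n
    for F-almost all n; it is an open neighborhood of z.

    Why a sticking argument works.  Fix a set A and a neighbornet U on it, and
    call a closed discrete subset D of A sticky if every point z of A that U
    does not cover from D has N z disjoint from D.  A union of sticky sets, each
    adding only points that the earlier ones left uncovered, is again sticky: a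
    point covered at some stage sees no later addition near it, and a point
    never covered has a neighborhood N z missing everything.  By Zorn's lemma it
    is enough to enlarge a sticky set so that it covers a given point y
    ([D_set_sticky]).  For this one needs a D-subset K of A that contains y and
    every z in A with N z meeting K: add to D what the D-property of K provides
    for the uncovered part of K.

    Where K comes from.  Take the set K of the t in A with y n <= t n for almost
    all n; transitivity of the order gives the closure property.  By T1, a point
    z of K has a neighborhood whose points in K differ from y at the same
    indices as z, up to F ([same_support_open]).  So K is a topological sum of
    pieces, and on a piece any two points either agree at n or both have rank
    above r (y n).  Ranks are bounded by m, so this improvement can be repeated
    at most m + 1 times before the pieces have at most one point; the induction
    is [D_set_spread]. *)

Set Implicit Arguments.
Unset Strict Implicit.
Unset Printing Implicit Defensive.

Local Open Scope classical_set_scope.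
Local Open Scope quotient_scope.

(** * The D-property of subsets *)

Section relative_D.
Variable T : topologicalType.
Implicit Types A B D K W : set T.

Definition closed_discrete_in A D :=
  D `<=` A /\
  forall z, A z -> exists W, [/\ open W, W z & W `&` D `<=` [set z]].

Definition neighbornet_on A (U : T -> set T) :=
  forall x, A x -> open (U x) /\ U x x.

(** The D-property of the subspace A, with neighbornets, closedness and
    discreteness all expressed by open sets of the ambient space, so that the
    argument never has to pass between subspaces of subspaces. *)
Definition D_set A := forall U, neighbornet_on A U ->
  exists2 D, closed_discrete_in A D & A `<=` \bigcup_(x in D) U x.

Lemma hereditarily_D_sets : (forall A, D_set A) -> hereditarily_D T.
Proof.
move=> DT A U nU.
have /choice[W WP] : forall a : A, exists W, open W /\ set_val @^-1` W = U a.
  by move=> a; have [[W oW WU] _] := nU a; exists W.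
(* A neighbornet on the ambient space that extends the W a; the union has one
   term at points of A and none elsewhere. *)
pose U' t := \bigcup_(a in [set a : A | set_val a = t]) W a.
have nU' : neighbornet_on A U'.
  move=> x Ax; split; first by apply: bigcup_open => a _; case: (WP a).
  exists (exist _ x (mem_set Ax)) => //.
  have [_ WU] := WP (exist _ x (mem_set Ax)).
  by have [_] := nU (exist _ x (mem_set Ax)); rewrite -WU.
have [D [DA Ddisc] AD] := DT A U' nU'.
have Dn (z : A) : exists V : set A,
    [/\ nbhs z V, V z & V `&` (set_val @^-1` D) `<=` [set z]].
  have [V [oV Vz VD]] := Ddisc (set_val z) (set_mem (valP z)).
  exists (set_val @^-1` V); split=> //.
    by apply: open_nbhs_nbhs; split=> //; exists V.
  by move=> a aVD; apply: val_inj; exact: VD.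
exists (set_val @^-1` D); split.
- move=> z zD; have [V [nV _ VD]] := Dn z.
  by have [a [Da Va]] := zD V nV; rewrite -(VD a).
- apply/seteqP; split=> [|z Dz]; first exact: isolatedS.
  split; first exact: mem_set.
  have [V [nV Vz VD]] := Dn z; exists V => //.
  by apply/seteqP; split=> // _ ->.
- apply/seteqP; split=> // x _.
  have [d Dd [a /= ad Wx]] := AD (set_val x) (set_mem (valP x)).
  exists a; first by rewrite /= ad.
  by have [_ <-] := WP a.
Qed.

(** Relatively closed subsets of D-sets are D-sets: enlarge every neighborhood
    by the removed open set B, and assign B itself to the points of B. *)
Lemma D_set_setD A B : open B -> D_set A -> D_set (A `\` B).
Proof.
move=> oB DA U nU.
pose U' x := B `|` [set y | ~ B x /\ U x y].
have nU' : neighbornet_on A U'.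
  move=> x Ax; have [Bx|nBx] := pselect (B x).
    rewrite /U' (_ : [set y | _] = set0) ?setU0//.
    by apply/seteqP; split=> // y [].
  have [oU Ux] := nU x (conj Ax nBx).
  rewrite /U' (_ : [set y | _] = U x); last first.
    by apply/seteqP; split=> // y [].
  by split; [exact: openU|right].
have [D [DsA Dd] AD] := DA U' nU'.
exists (D `\` B); first split.
- by move=> x [Dx nBx]; split=> //; exact: DsA.
- move=> z [Az _]; have [W [oW Wz WD]] := Dd z Az; exists W; split=> //.
  by move=> x [Wx [Dx _]]; exact: WD.
- move=> x [Ax nBx]; have [d Dd' [//|[nBd Ux]]] := AD x Ax.
  by exists d.
Qed.

(** A topological sum of D-sets is a D-set: a neighborhood of z inside the class
    of z sees only the closed discrete set chosen for that class. *)
Lemma D_set_sum A (e : T -> T -> Prop) :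
  (forall x, e x x) -> (forall x y, e x y -> e y x) ->
  (forall x y z, e x y -> e y z -> e x z) ->
  (forall z, A z -> exists W, [/\ open W, W z & W `&` A `<=` e z]) ->
  (forall x, A x -> D_set (A `&` e x)) -> D_set A.
Proof.
move=> e_refl e_sym e_trans e_open DA U nU.
(* The choice depends on the class as a set, so that equivalent points get
   the same closed discrete set. *)
have /choice[Dp DpP] : forall P : set T, exists D, forall x, A x ->
    P = A `&` e x -> closed_discrete_in P D /\ P `<=` \bigcup_(x in D) U x.
  move=> P; have [[x [Ax Px]]|nP] := pselect (exists x, A x /\ P = A `&` e x).
    have [|D cD PD] := DA x Ax U; first by move=> y [/nU].
    by exists D => _ _ _; rewrite Px.
  by exists set0 => x Ax Px; case: nP; exists x.
have class_eq x y : e x y -> A `&` e x = A `&` e y.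
  move=> xy; apply/seteqP; split=> z [Az ez]; split=> //.
    exact: e_trans (e_sym _ _ xy) ez.
  exact: e_trans xy ez.
exists (\bigcup_(x in A) Dp (A `&` e x)); first split.
- by move=> z [x Ax Dz]; have [[+ _] _] := DpP _ x Ax erefl; move=> /(_ z Dz)[].
- move=> z Az; have [W [oW Wz We]] := e_open z Az.
  have [[_ /(_ z) Dd] _] := DpP _ z Az erefl.
  have [|V [oV Vz VD]] := Dd; first by split.
  exists (V `&` W); split; [exact: openI|by split|].
  move=> y [[Vy Wy] [x Ax Dy]]; apply: VD; split=> //.
  have [[+ _] _] := DpP _ x Ax erefl => /(_ y Dy)[Ay exy].
  have ezy : e z y by apply: We.
  by rewrite (class_eq z y ezy) -(class_eq x y exy).
- move=> x Ax; have [_ /(_ x)[//|d Dd Ux]] := DpP _ x Ax erefl.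
  by exists d => //; exists x.
Qed.

(** * Sticky sets *)

Section sticky.
Variables (A : set T) (N U : T -> set T).
Hypotheses (nN : neighbornet_on A N) (nU : neighbornet_on A U).

(** Since N z is a neighborhood of z fixed in advance, no uncovered point can
    become an accumulation point of a union of a chain of sticky sets. *)
Definition sticky D := closed_discrete_in A D /\
  forall z, A z -> ~ (\bigcup_(x in D) U x) z -> N z `&` D = set0.

(** The added points lie outside what U already covers from D, so that the part
    covered from D acquires no new accumulation point. *)
Definition end_extends D D' :=
  D `<=` D' /\ forall x y, D x -> D' y -> U x y -> D y.

Lemma end_extends_trans D1 D2 D3 :
  end_extends D1 D2 -> end_extends D2 D3 -> end_extends D1 D3.
Proof.
move=> [s12 e12] [s23 e23]; split; first exact: subset_trans s12 s23.
move=> x y D1x D3y Uxy; apply: (e12 x) => //; apply: (e23 x) => //.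
exact: s12.
Qed.

Lemma sticky_chain (C : set (set T)) :
  (forall D, C D -> sticky D) -> total_on C end_extends ->
  sticky (\bigcup_(D in C) D) /\
  forall D, C D -> end_extends D (\bigcup_(D in C) D).
Proof.
move=> stC totC.
have ext D : C D -> end_extends D (\bigcup_(D in C) D).
  move=> CD; split; first exact: bigcup_sup.
  move=> x y Dx [D' CD' D'y] Uxy.
  have [[_ e]|[D'D _]] := totC D D' CD CD'; first exact: (e x).
  exact: D'D.
have NC z : A z -> ~ (\bigcup_(x in \bigcup_(D in C) D) U x) z ->
    N z `&` (\bigcup_(D in C) D) = set0.
  move=> Az nUz; apply/seteqP; split=> // y [Ny [D CD Dy]].
  have nDz : ~ (\bigcup_(x in D) U x) z.
    by move=> [x Dx Uxz]; apply: nUz; exists x => //; exists D.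
  by have [_ /(_ z Az nDz) /seteqP[/(_ y)]] := stC D CD; case.
split=> //; split=> //; split.
- by move=> y [D /stC[[+ _] _]]; apply.
- move=> z Az.
  have [[x [D CD Dx] Uxz]|nUz] :=
      pselect ((\bigcup_(x in \bigcup_(D in C) D) U x) z).
    have [[DA Dd] _] := stC D CD; have [W [oW Wz WD]] := Dd z Az.
    exists (W `&` U x); split=> //.
      by apply: openI => //; case: (nU (DA x Dx)).
    move=> y [[Wy Uxy] Cy]; apply: WD; split=> //.
    by have [_ e] := ext D CD; exact: (e x).
  have [oN Nz] := nN Az; exists (N z); split=> //.
  by rewrite NC.
Qed.

(** K is relatively closed because N z misses K for z outside K; the closed
    discrete set E obtained for the uncovered part of K is therefore closed
    discrete in A, and no uncovered point z has N z meeting E, since such a z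
    would lie in K and be covered. *)
Lemma sticky_extend D K y : sticky D -> D_set K -> K `<=` A -> K y ->
  (forall z, A z -> N z `&` K !=set0 -> K z) ->
  exists D', [/\ sticky D', end_extends D D' & (\bigcup_(x in D') U x) y].
Proof.
move=> [[DA Dd] Dst] DK KA Ky Kcl.
have oUD : open (\bigcup_(x in D) U x).
  by apply: bigcup_open => x Dx; case: (nU (DA x Dx)).
have [|E [EK Ed] KE] := D_set_setD oUD DK (U := U).
  by move=> x [/KA/nU].
exists (D `|` E); split; last first.
- have [[x Dx Uxy]|nUy] := pselect ((\bigcup_(x in D) U x) y).
    by exists x => //; left.
  by have [|x Ex Uxy] := KE y; [split|exists x => //; right].
- split; first by left.
  move=> x z Dx [//|/EK[_ nUz]] Uxz; case: nUz; by exists x.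
have NK z : A z -> ~ K z -> N z `&` E = set0.
  move=> Az nKz; apply/seteqP; split=> // x [Nx /EK[Kx _]].
  by apply: nKz; apply: Kcl => //; exists x.
split; first split.
- by move=> x [/DA//|/EK[/KA]].
- move=> z Az.
  have [UDz|nUDz] := pselect ((\bigcup_(x in D) U x) z).
    have [W [oW Wz WD]] := Dd z Az.
    exists (W `&` \bigcup_(x in D) U x); split; [exact: openI|by split|].
    by move=> x [[Wx UDx] [Dx|/EK[]//]]; apply: WD.
  have [oN Nz] := nN Az; have ND := Dst z Az nUDz.
  have [Kz|nKz] := pselect (K z).
    have [W [oW Wz WE]] := Ed z (conj Kz nUDz).
    exists (N z `&` W); split; [exact: openI|by split|].
    move=> x [[Nx Wx] [Dx|Ex]]; last exact: WE.
    by have : (N z `&` D) x by []; rewrite ND.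
  exists (N z); split=> // x [Nx [Dx|Ex]].
    by have : (N z `&` D) x by []; rewrite ND.
  by have : (N z `&` E) x by []; rewrite NK.
- move=> z Az nUz.
  have nUDz : ~ (\bigcup_(x in D) U x) z.
    by move=> [x Dx Ux]; apply: nUz; exists x => //; left.
  rewrite setIUr Dst// set0U NK// => Kz.
  by have [//|x Ex Ux] := KE z; apply: nUz; exists x => //; right.
Qed.

End sticky.

(** A maximal sticky set covers A.  The neighbornet N, unlike the one to be
    covered with, is fixed beforehand, so K does not depend on U. *)
Lemma D_set_sticky A N : neighbornet_on A N ->
  (forall y, A y -> exists K,
     [/\ K `<=` A, K y,
         (forall z, A z -> N z `&` K !=set0 -> K z) & D_set K]) ->
  D_set A.
Proof.
move=> nN AK U nU.
pose R (D D' : {D | sticky A N U D}) := `[< end_extends U (sval D) (sval D') >].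
have sticky0 : sticky A N U set0.
  split; last by move=> z _ _; rewrite setI0.
  by split=> // z /nN[oN Nz]; exists (N z); split=> // x [].
have [||C totC|[D stD] Dmax] := ZL_preorder (exist _ set0 sticky0) (R := R).
- by move=> D; apply/asboolP; split.
- move=> D1 D2 D3 /asboolP e12 /asboolP e23; apply/asboolP.
  exact: end_extends_trans e12 e23.
- have [] := @sticky_chain A N U nN nU (sval @` C).
  + by move=> _ [[D stD] _ <-].
  + move=> _ _ [D CD <-] [D' CD' <-].
    by have [/asboolP|/asboolP] := totC D D' CD CD'; [left|right].
  + move=> stC extC; exists (exist _ _ stC) => D CD; apply/asboolP.
    by apply: extC; exists D.
exists D; first by have [] := stD.
move=> y Ay; have [K [KA Ky Kcl DK]] := AK y Ay.
have [D' [stD' eD' D'y]] := sticky_extend nN nU stD DK KA Ky Kcl.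
have /asboolP[/= D'D _] := Dmax (exist _ D' stD') (asboolT eD').
by have [x D'x Ux] := D'y; exists x => //; exact: D'D.
Qed.

End relative_D.

(** * Ranks in spaces of finite scattered height *)

Section rank.
Variable X : topologicalType.

Definition rank_le (r : X -> nat) (x y : X) := x = y \/ r x < r y.

Lemma rank_le_trans r y x z : rank_le r x y -> rank_le r y z -> rank_le r x z.
Proof.
move=> [->//|xy] [<-|yz]; right=> //; exact: ltn_trans xy yz.
Qed.

Lemma rank_le_anti r x y : rank_le r x y -> rank_le r y x -> x = y.
Proof.
move=> [//|xy] [//|yx].
by have := ltn_trans xy yx; rewrite ltnn.
Qed.

(** What the proof uses of Cantor-Bendixson ranks bounded by m: the principal
    lower sets of the order that they induce are open. *)
Definition open_ranking (m : nat) (r : X -> nat) :=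
  (forall x, r x <= m) /\ (forall x, open [set y | rank_le r y x]).

(** The rank of x is the last i with x in the i-th derivative.  As x is isolated
    there, it has a neighborhood in which every other point has smaller rank;
    the lower set of x is the union of such neighborhoods of its points. *)
Lemma scattered_height_rank m : scattered_height_le X m ->
  exists r, open_ranking m r.
Proof.
move=> hX; pose L i := cb_derivative X (iter i OSucc OZero).
have LS i x : L i x -> ~ isolated (L i) x -> L i.+1 x by split.
have Lm x : ~ L m.+1 x.
  move=> Lx; have /hX : cb_derivative X (iter m.+1 OSucc OZero) !=set0.
    by exists x.
  by elim: (m) => //= k; apply.
have Lle i j x : i <= j -> L j x -> L i x.
  by move=> /subnK <-; elim: (j - i) => // k IH [/IH].
have /choice[r rP] x : exists i, [/\ i <= m, L i x & ~ L i.+1 x].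
  have : ~ (forall i, L i x -> L i.+1 x).
    by move=> LL; apply: (Lm x); elim: m.+1 => // k; exact: LL.
  move=> /existsNP[i /not_implyP[Li nLi]]; exists i; split=> //.
  by rewrite leqNgt; apply/negP => /(Lle _ _ x)/(_ Li)/Lm.
have /choice[O OP] x : exists O, [/\ open O, O x & O `&` L (r x) `<=` [set x]].
  have [_ Lx nLx] := rP x.
  have [_ [V nV VL]] : isolated (L (r x)) x.
    by apply: contrapT => nI; apply: nLx; exact: LS.
  exists V°; split; [exact: open_interior|exact: nV|].
  by rewrite -VL; apply: setSI; exact: interior_subset.
have Or x y : O x y -> rank_le r y x.
  move=> Oy; have [_ _ OL] := OP x; have [_ Ly _] := rP y.
  have [rxy|] := leqP (r x) (r y); last by right.
  by left; apply: OL; split=> //; exact: Lle Ly.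
exists r; split=> [x|x]; first by have [] := rP x.
rewrite (_ : [set y | _] = \bigcup_(y in [set y | rank_le r y x]) O y).
  by apply: bigcup_open => y _; have [] := OP y.
apply/seteqP; split=> [y yx|z [y yx /Or zy]]; last exact: rank_le_trans zy yx.
by exists y => //; have [] := OP y.
Qed.

End rank.

(** * Products modulo a filter *)

Section reduced_product.
Variables (m : nat) (X : nat -> topologicalType).
Variable r : forall n, X n -> nat.
Hypothesis X_T1 : forall n, accessible_space (X n).
Hypothesis rX : forall n, open_ranking m (@r n).

Variables (T : topologicalType) (rep : T -> forall n, X n).
Variables (F : set_system nat) (FF : Filter F).
(* [rep] chooses representatives, which embeds T as a set in the product modulo
   F; the topology of T is at least as fine as the one that the boxes modulo F
   generate. *)
Hypothesis rep_inj : forall s t,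
  (\forall n \near F, rep s n = rep t n) -> s = t.
Hypothesis open_rep : forall U : forall n, set (X n), (forall n, open (U n)) ->
  open [set t | \forall n \near F, U n (rep t n)].

(** The induction measure: where points of A differ, their ranks are among the k
    largest of 0, ..., m. *)
Definition spread_le k (A : set T) := forall s t, A s -> A t ->
  \forall n \near F, rep s n = rep t n \/ m < k + r (rep s n).

(** Equality modulo F of the sets of indices at which s and t differ from y. *)
Definition same_support (y s t : T) := \forall n \near F,
  rep s n = rep y n <-> rep t n = rep y n.

Definition upper_set (y : T) : set T :=
  [set t | \forall n \near F, rank_le (@r n) (rep y n) (rep t n)].

Definition lower_set (z : T) : set T :=
  [set t | \forall n \near F, rank_le (@r n) (rep t n) (rep z n)].

Lemma lower_set_neighbornet A : neighbornet_on A lower_set.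
Proof.
move=> z _; split.
  apply: (open_rep (U := fun n => [set p | rank_le (@r n) p (rep z n)])) => n.
  by have [_] := rX n.
by apply: nearW => n; left.
Qed.

Lemma upper_set_closed y z : lower_set z `&` upper_set y !=set0 ->
  upper_set y z.
Proof.
move=> [x [Nx Kx]]; apply: (filterS2 _ _ Nx Kx) => n Nn Kn.
exact: rank_le_trans Kn Nn.
Qed.

(** The neighborhood W keeps t n off y n wherever z n <> y n, by T1.  Where
    z n = y n, both t n <= y n and y n <= t n hold in the order of ranks. *)
Lemma same_support_open y z :
  exists W, [/\ open W, W z & W `&` upper_set y `<=` same_support y z].
Proof.
pose U n :=
  [set p | rank_le (@r n) p (rep z n)] `&`
  [set p | rep z n <> rep y n -> p <> rep y n].
exists [set t | \forall n \near F, U n (rep t n)]; split.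
- apply: (open_rep (U := U)) => n; apply: openI.
    by have [_] := rX n.
  have [zy|zy] := pselect (rep z n = rep y n).
    rewrite (_ : [set p | _] = setT); first exact: openT.
    by apply/seteqP; split=> // p _ /=.
  rewrite (_ : [set p | _] = ~` [set rep y n]).
    by apply: closed_openC; exact: accessible_closed_set1.
  by apply/seteqP; split=> p /= py; [exact: py|move=> _].
- by apply: nearW => n; split=> //; left.
- move=> t [Wt Kt]; apply: (filterS2 _ _ Wt Kt) => n [Ot nt] Ktn.
  split=> [zy|]; last by move=> ty; apply: contrapT => /nt; exact.
  by apply: rank_le_anti Ktn; rewrite -zy.
Qed.

(** For k = 0 the set A has at most one point.  For the step, the points of
    A above y split into pieces with the same support relative to y; where two
    points of a piece differ, both differ from y, and their ranks exceed that
    of y. *)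
Lemma D_set_spread k A : spread_le k A -> D_set A.
Proof.
elim: k A => [|k IH] A spA.
  have A1 s t : A s -> A t -> s = t.
    move=> As At; apply: rep_inj; apply: (filterS _ (spA s t As At)) => n [//|].
    by rewrite add0n ltnNge; have [->] := rX n.
  move=> U nU; exists A; last by move=> x Ax; exists x => //; case: (nU x Ax).
  split=> // z Az; have [oU Uz] := nU z Az; exists (U z); split=> // x [_ Ax].
  exact: A1.
apply: (D_set_sticky (lower_set_neighbornet (A := A))) => y Ay.
exists (A `&` upper_set y); split.
- by move=> ? [].
- by split=> //; apply: nearW => n; left.
- move=> z Az [x [Nx [_ Kx]]]; split=> //; apply: upper_set_closed.
  by exists x.
apply: (@D_set_sum _ _ (same_support y)).
- by move=> x; exact: nearW.
- by move=> s t; apply: filterS => n [].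
- by move=> s t u; apply: filterS2 => n st tu; rewrite st.
- move=> z _; have [W [oW Wz We]] := same_support_open y z.
  by exists W; split=> // t [Wt [_ Kt]]; apply: We.
move=> x [Ax Kx]; apply: IH => s t [[As Ks] es] [[At Kt] et].
have est : \forall n \near F, rep s n = rep y n <-> rep t n = rep y n.
  by apply: (filterS2 _ _ es et) => n <-.
apply: (filterS3 _ _ (spA y s Ay As) est Ks) => n spn estn Ksn.
have [sy|sy] := pselect (rep s n = rep y n).
  by left; rewrite sy; apply/esym/estn.
right; have [/esym/sy//|rys] := Ksn.
case: spn => [/esym/sy//|]; rewrite addSnnS => /leq_trans; apply.
by rewrite leq_add2l.
Qed.

Lemma hereditarily_D_reduced_product : hereditarily_D T.
Proof.
apply: hereditarily_D_sets => A; apply: (@D_set_spread m.+1) => s t _ _.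
by apply: nearW => n; right; rewrite addSn leq_addr.
Qed.

End reduced_product.

(** * Box and nabla products *)

Section boxes.
Variable X : nat -> topologicalType.

Lemma box_open (U : forall n, set (X n)) : (forall n, open (U n)) ->
  open (box U).
Proof.
move=> oU; exists [set U]; first by move=> _ ->.
by rewrite bigcup_set1.
Qed.

Definition cofinite : set_system nat := [set A | finite_set (~` A)].

Lemma cofinite_filter : Filter cofinite.
Proof.
split=> [|A B fA fB|A B AB]; rewrite /cofinite /=.
- by rewrite setCT.
- by rewrite setCI finite_setU.
- by apply: sub_finite_set; exact: subsetC.
Qed.

Lemma nabla_eqP (x y : box_product X) :
  \pi_(nabla_product X) x = \pi_(nabla_product X) y <->
  cofinite [set n | x n = y n].
Proof.
split=> [/eqmodP/asboolP//|xy]; apply/eqmodP/asboolP; exact: xy.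
Qed.

(** The preimage in the box product is open because a point x of it lies in the
    box V x, where U n is relaxed to the whole space at the finitely many n with
    x n outside U n. *)
Lemma nabla_open (U : forall n, set (X n)) : (forall n, open (U n)) ->
  open [set t : nabla_product X | cofinite [set n | U n (repr t n)]].
Proof.
move=> oU; rewrite /open /= /quotient_open.
have FF := cofinite_filter.
pose V (x : box_product X) n := if pselect (U n (x n)) then U n else setT.
have VU x n : U n (x n) -> V x n = U n by rewrite /V; case: pselect.
have reprE x : cofinite [set n | repr (\pi_(nabla_product X) x) n = x n].
  by apply/nabla_eqP; rewrite reprK.
rewrite (_ : _ @^-1` _ = \bigcup_(x in [set x : box_product X |
    cofinite [set n | U n (x n)]]) box (V x)).
  apply: bigcup_open => x _; apply: box_open => n.
  by rewrite /V; case: pselect => Uxn /=; [exact: oU|exact: openT].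
apply/seteqP; split=> [x Ux|y [x Ux Vy]] /=.
  exists x; last by move=> n; rewrite /V; case: pselect.
  by apply: (filterS2 _ _ Ux (reprE x)) => n /= Uxn <-.
apply: (filterS2 _ _ Ux (reprE y)) => n /= Uxn ->.
by rewrite -(VU x n Uxn); exact: Vy.
Qed.

End boxes.

Theorem proposition20 (m : nat) (X : nat -> topologicalType)
    (X_T1 : forall n, accessible_space (X n))
    (X_scattered : forall n, scattered (X n))
    (X_height : forall n, scattered_height_le (X n) m) :
  hereditarily_D (box_product X) /\ hereditarily_D (nabla_product X).
Proof.
have rX n := cid (scattered_height_rank (X_height n)).
have cofF := cofinite_filter.
split.
- apply: (hereditarily_D_reduced_product X_T1 (fun n => svalP (rX n))
    (rep := fun x : box_product X => x) (F := globally setT)).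
  + move=> s t st; apply: functional_extensionality_dep => n; exact: st.
  + move=> U oU; rewrite (_ : [set t | _] = box U); first exact: box_open.
    by apply/seteqP; split=> x Ux n => [|_]; exact: Ux.
- apply: (hereditarily_D_reduced_product X_T1 (fun n => svalP (rX n))
    (rep := fun x : nabla_product X => repr x : box_product X) (F := cofinite)).
  + move=> s t st; rewrite -[s]reprK -[t]reprK; exact/nabla_eqP.
  + exact: nabla_open.
Qed.
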